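(* Let $d\ge 3$. There are at least $2^{d-1}-2$ different permutations $\sigma$ of $[d-1]$ that are universal types for oriented lines in $\mathbb{R}^d$, i.e. such that for every $n\ge d-1$ there exists a sequence of $n$ oriented lines in $\mathbb{R}^d$ which is homogeneous of type $\sigma$.
   Context: An oriented line in $\mathbb{R}^d$ is an equivalence class of pairs $(a,v)$ with $a,v\in\mathbb{R}^d$, $v\neq 0$, where $(a,v)\sim(a+\alpha v,\beta v)$ for all $\alpha\in\mathbb{R}$, $\beta>0$. For an ordered $(d-1)$-tuple $L_1,\ldots,L_{d-1}$ with $L_i$ represented by $(a_i,v_i)$, set $h_i=\det(a_i,v_1,\ldots,v_{d-1})$ (determinant of the $d\times d$ matrix with these columns). The tuple is in general position if the $h_i$ are pairwise distinct, and then its type is the permutation $\sigma$ of $[d-1]$ with $h_{\sigma(1)}<\dots<h_{\sigma(d-1)}$. A sequence $K_1,\ldots,K_n$ of oriented lines is homogeneous of type $\sigma$ if every subsequence $K_{i_1},\ldots,K_{i_{d-1}}$ with $i_1<\dots<i_{d-1}$ is in general position and has type $\sigma$. *)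

(* Defs.v *)
From HB Require Import structures.
From mathcomp Require Import all_boot all_order all_algebra all_fingroup.
From mathcomp Require Import generic_quotient.
From mathcomp Require Import boolp reals.

Set Implicit Arguments.
Unset Strict Implicit.
Unset Printing Implicit Defensive.

Import Order.TTheory GRing.Theory Num.Theory.
Local Open Scope ring_scope.
Local Open Scope quotient_scope.

Section OrientedLines.
Variables (R : realType) (d : nat).

Definition line_rep := {p : 'cV[R]_d * 'cV[R]_d | p.2 != 0}.

Definition base_point (p : line_rep) : 'cV[R]_d := (val p).1.
Definition direction (p : line_rep) : 'cV[R]_d := (val p).2.

Definition same_line (p q : line_rep) : Prop :=
  exists alpha beta : R, [/\ 0 < beta,
    base_point q = base_point p + alpha *: direction p &
    direction q = beta *: direction p].

Definition same_lineb (p q : line_rep) : bool := `[< same_line p q >].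

Lemma same_lineb_refl : reflexive same_lineb.
Proof.
move=> p; apply/asboolP; exists 0, 1.
by rewrite ltr01 scale0r addr0 scale1r.
Qed.

Lemma same_line_sym p q : same_line p q -> same_line q p.
Proof.
case=> [al [be [be0 ea ev]]]; exists (- (al / be)), be^-1.
have be_neq0 : be != 0 by rewrite gt_eqF.
split; first by rewrite invr_gt0.
- by rewrite ea ev scalerA mulNr divfK // scaleNr addrK.
- by rewrite ev scalerA mulVf // scale1r.
Qed.

Lemma same_lineb_sym : symmetric same_lineb.
Proof. by move=> p q; apply/asboolP/asboolP; apply: same_line_sym. Qed.

Lemma same_lineb_trans : transitive same_lineb.
Proof.
move=> q p r /asboolP [al [be [be0 ea ev]]] /asboolP [al' [be' [be0' ea' ev']]].
apply/asboolP; exists (al + al' * be), (be' * be); split.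
- exact: mulr_gt0.
- by rewrite ea' ea ev scalerA scalerDl addrA.
- by rewrite ev' ev scalerA.
Qed.

Canonical same_line_equiv :=
  EquivRel same_lineb same_lineb_refl same_lineb_sym same_lineb_trans.

Definition oriented_line := {eq_quot same_line_equiv}.

(* Columns a, v_0, ..., v_(d-2). *)
Definition column_matrix (a : 'cV[R]_d) (v : 'I_d.-1 -> 'cV[R]_d) : 'M[R]_d :=
  \matrix_(r < d, c < d) (nth 0 (a :: codom v) c) r ord0.

Definition height_rep (p : 'I_d.-1 -> line_rep) (i : 'I_d.-1) : R :=
  \det (column_matrix (base_point (p i)) (fun j => direction (p j))).

(* Computed on canonical representatives; by [height_repE] below, another
   choice multiplies all heights of the tuple by a common positive factor. *)
Definition height (L : 'I_d.-1 -> oriented_line) : 'I_d.-1 -> R :=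
  height_rep (fun i => repr (L i)).

Definition general_position (L : 'I_d.-1 -> oriented_line) : Prop :=
  injective (height L).

Definition has_type (L : 'I_d.-1 -> oriented_line) (s : 'S_d.-1) : Prop :=
  forall i j : 'I_d.-1, (i < j)%N -> height L (s i) < height L (s j).

Definition homogeneous n (K : 'I_n -> oriented_line) (s : 'S_d.-1) : Prop :=
  forall f : 'I_d.-1 -> 'I_n, (forall i j : 'I_d.-1, (i < j)%N -> (f i < f j)%N) ->
    general_position (K \o f) /\ has_type (K \o f) s.

Definition universal_type (s : 'S_d.-1) : Prop :=
  forall n, (d.-1 <= n)%N ->
    exists K : 'I_n -> oriented_line, homogeneous K s.

End OrientedLines.

Lemma column_matrixE (R : realType) m (a : 'cV[R]_(1 + m)) v :
  column_matrix a v = row_mx a (\matrix_(r < 1 + m, c < m) v c r ord0).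
Proof.
apply/matrixP => r c; rewrite !mxE; case: splitP => j ->.
  by rewrite !ord1.
rewrite /= mxE (nth_map j); last by rewrite size_enum_ord; exact: ltn_ord.
by rewrite nth_ord_enum.
Qed.

Lemma det_column_matrix_change (R : realType) m (a : 'cV[R]_(1 + m))
    (v : 'I_m -> 'cV[R]_(1 + m)) (al : R) (be : 'I_m -> R) (i : 'I_m) :
  \det (column_matrix (a + al *: v i) (fun j => be j *: v j)) =
  (\prod_j be j) * \det (column_matrix a v).
Proof.
rewrite !column_matrixE.
set V := \matrix_(r, c) v c r ord0.
have -> : row_mx (a + al *: v i) (\matrix_(r, c) (be c *: v c) r ord0) =
    row_mx a V *m
    block_mx 1%:M 0 (al *: delta_mx i 0) (diag_mx (\row_j be j)).
  rewrite mul_row_block mulmx1 mulmx0 add0r; congr row_mx.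
    congr (_ + _); rewrite -scalemxAr -colE; congr (_ *: _).
    by apply/matrixP => r c; rewrite !mxE ord1.
  by apply/matrixP => r c; rewrite mul_mx_diag !mxE mulrC.
rewrite det_mulmx det_lblock det1 mul1r det_diag mulrC.
by congr (_ * _); apply: eq_bigr => j _; rewrite mxE.
Qed.

Lemma height_repE (R : realType) d (L : 'I_d.-1 -> oriented_line R d)
    (p : 'I_d.-1 -> line_rep R d) :
  (forall i, \pi_(oriented_line R d) (p i) = L i) ->
  exists2 c : R, 0 < c & forall i, height_rep p i = c * height L i.
Proof.
case: d L p => [|m] L p pL; first by exists 1 => // -[].
have /choice [al /choice [be E]] i : exists al be, [/\ 0 < be,
    base_point (p i) = base_point (repr (L i)) + al *: direction (repr (L i)) &
    direction (p i) = be *: direction (repr (L i))].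
  suff /asboolP : same_lineb (repr (L i)) (p i) by [].
  by apply/eqmodP; rewrite reprK pL.
exists (\prod_i be i) => [|i]; first by apply: prodr_gt0 => i _; case: (E i).
rewrite /height /height_rep -(det_column_matrix_change _ _ (al i) be i).
have [_ -> _] := E i; congr (\det (column_matrix _ _)).
by apply/funext => j; have [_ _ ->] := E j.
Qed.

Lemma general_position_rep (R : realType) d (L : 'I_d.-1 -> oriented_line R d)
    (p : 'I_d.-1 -> line_rep R d) :
  (forall i, \pi_(oriented_line R d) (p i) = L i) ->
  general_position L <-> injective (height_rep p).
Proof.
move=> /height_repE [c c0 E]; split=> inj i j.
  by rewrite !E => /(mulfI (lt0r_neq0 c0)) /inj.
by move=> eqh; apply: inj; rewrite !E eqh.
Qed.

Lemma has_type_rep (R : realType) d (L : 'I_d.-1 -> oriented_line R d)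
    (p : 'I_d.-1 -> line_rep R d) (s : 'S_d.-1) :
  (forall i, \pi_(oriented_line R d) (p i) = L i) ->
  has_type L s <->
  forall i j : 'I_d.-1, (i < j)%N -> height_rep p (s i) < height_rep p (s j).
Proof.
move=> /height_repE [c c0 E].
by split=> H i j /H; rewrite !E ltr_pM2l.
Qed.

(* Main.v *)
(** Take the directions [v_j] on the moment curve, at nodes [t_1 < ... < t_m]
with [m = d - 1].  Up to the positive Vandermonde factor, the height of a base
point [a] is then the pairing of [a] with the coefficients of
[\prod_j (X - t_j)].  Let the coordinates of the [i]-th base point be
[c_k * x^k], where [c_k] is a sign and [x] lies just below [t_i].  The pairing
expands into one term for each set of nodes, and when the nodes are widely
separated a single term dominates all the others: that of [{t_j | j < i}], of
absolute value [\prod_j max (x, t_j)].  The height thus has the sign prescribed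
for the rank [i], and its absolute value grows quickly with [i].  A word [s] is
the type of such a tuple as soon as it decreases and then increases, the entries
of its decreasing part being given negative heights.  Reversing the sequence of
lines replaces each entry of the type by its mirror image, hence the words that
increase and then decrease are universal as well.  There are [2^(m-1)] words of
each kind, and only the two monotone words are of both. *)

Require Import Defs.
From mathcomp Require Import all_boot all_order all_algebra all_fingroup.
From mathcomp Require Import generic_quotient boolp reals.
From mathcomp Require Import zify ring lra.

Set Implicit Arguments.
Unset Strict Implicit.
Unset Printing Implicit Defensive.

Import Order.TTheory GRing.Theory Num.Theory.
Local Open Scope ring_scope.
Local Open Scope quotient_scope.

Definition rev_perm m : 'S_m := perm (@rev_ord_inj m).

Lemma rev_permK m : involutive (rev_perm m).
Proof. by move=> i; rewrite !permE rev_ordK. Qed.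

Lemma rev_permV m : (rev_perm m)^-1%g = rev_perm m.
Proof.
apply/permP => i; apply: (can_inj (@rev_permK m)).
by rewrite permKV rev_permK.
Qed.

Lemma rev_perm_ltn m (i j : 'I_m) :
  (rev_perm m i < rev_perm m j)%N = (j < i)%N.
Proof. by rewrite !permE /=; have := ltn_ord i; have := ltn_ord j; lia. Qed.

Lemma increasing_perm1 m (s : 'S_m) :
  {homo s : i j / (i < j)%N} -> s = 1%g.
Proof.
move=> s_incr; apply/permP => i; rewrite perm1.
have enum_incr : sorted (relpre val ltn) (enum 'I_m).
  by rewrite -(sorted_map (f := val) (e' := ltn)) val_enum_ord iota_ltn_sorted.
have s_enum : map s (enum 'I_m) = enum 'I_m.
  apply: (@irr_sorted_eq _ (relpre val ltn)) => //.
  - by move=> j k l; apply: ltn_trans.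
  - by move=> j; rewrite /= ltnn.
  - exact: (homo_sorted (e := relpre val ltn)).
  by move=> j; rewrite -[j](permKV s) (mem_map perm_inj) !mem_enum.
by rewrite -[i in LHS](nth_ord_enum i i) -(nth_map i i) ?size_enum_ord //
  s_enum nth_ord_enum.
Qed.

(* The words that decrease and then increase, that is, those without an interior
   peak. *)
Definition valley_perms m : {set 'S_m} :=
  [set s : 'S_m | [forall i : 'I_m, forall j : 'I_m, forall k : 'I_m,
     (i < j < k)%N ==> (s j < maxn (s i) (s k))%N]].

Lemma valley_permsP m (s : 'S_m) :
  reflect (forall i j k : 'I_m, (i < j)%N -> (j < k)%N ->
             (s j < maxn (s i) (s k))%N)
          (s \in valley_perms m).
Proof.
rewrite inE; apply: (iffP 'forall_'forall_forallP) => valley i j k.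
  by move=> ltij ltjk; have := valley i j k; rewrite ltij ltjk.
by apply/implyP => /andP[]; apply: valley.
Qed.

Lemma lift_perm_inj m (i j : 'I_m.+1) : injective (lift_perm i j).
Proof.
move=> s s' eq_lift; apply/permP => k; apply: (@lift_inj _ j).
by rewrite -!(lift_perm_lift i) eq_lift.
Qed.

Lemma lift_perm_max_ltn m (i : 'I_m.+1) (s : 'S_m) (j : 'I_m.+1) :
  j != i -> (lift_perm i ord_max s j < m)%N.
Proof.
rewrite eq_sym => /unlift_some[k -> _].
by rewrite lift_perm_lift lift_max.
Qed.

Definition end_position m (b : bool) : 'I_m.+1 := if b then ord_max else ord0.

Lemma valley_lift_perm m (b : bool) (s : 'S_m) : s \in valley_perms m ->
  lift_perm (end_position m b) ord_max s \in valley_perms m.+1.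
Proof.
move=> /valley_permsP valley; apply/valley_permsP => i j k ltij ltjk.
set e := end_position m b; set s' := lift_perm e ord_max s.
have s'_end : s' e = m :> nat by rewrite /s' lift_perm_id.
have neje : j != e.
  by rewrite /e -val_eqE; case: b {e s' s'_end} => /=; have := ltn_ord k; lia.
have s'j_lt : (s' j < m)%N by rewrite lift_perm_max_ltn.
have [->|neie] := eqVneq i e; first by rewrite leq_max s'_end s'j_lt.
have [->|neke] := eqVneq k e; first by rewrite leq_max s'_end s'j_lt orbT.
move: neie neje neke ltij ltjk; rewrite ![_ == e]eq_sym /s'.
move=> /unlift_some[i' -> _] /unlift_some[j' -> _] /unlift_some[k' -> _].
move=> ltij ltjk.
rewrite !lift_perm_lift !lift_max.
by apply: valley; rewrite ltnNge -(leq_bump2 e) -ltnNge.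
Qed.

Lemma card_valley_perms m : (2 ^ m.-1 <= #|valley_perms m|)%N.
Proof.
case: m => [|m] /=.
  by apply/card_gt0P; exists 1%g; apply/valley_permsP; case.
elim: m => [|m IHm].
  apply/card_gt0P; exists 1%g; apply/valley_permsP => i j k.
  by rewrite !ord1.
pose extend (bs : bool * 'S_m.+1) :=
  lift_perm (end_position m.+1 bs.1) ord_max bs.2.
have extend_inj : injective extend.
  have max_end b c s : extend (b, s) (end_position m.+1 c) = ord_max -> c = b.
    have [-> //|neq_cb] := eqVneq c b.
    have : (extend (b, s) (end_position m.+1 c) < m.+1)%N.
      by apply: lift_perm_max_ltn; case: b c neq_cb => [] [].
    by move=> lt_max eq_max; rewrite eq_max ltnn in lt_max.
  move=> [b s] [c s'] eq_ext; have eq_bc : b = c.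
    by apply: (max_end c b s'); rewrite -eq_ext /extend lift_perm_id.
  by move: eq_ext; rewrite -eq_bc /extend /= => /lift_perm_inj ->.
pose domain := setX [set: bool] (valley_perms m.+1).
apply: (@leq_trans #|extend @: domain|).
  by rewrite card_imset // cardsX cardsT card_bool expnS leq_mul2l.
apply/subset_leq_card/subsetP => _ /imsetP[[b s] /setXP[_ valley] ->].
exact: valley_lift_perm.
Qed.

Definition mountain_perms m : {set 'S_m} := (valley_perms m :* rev_perm m)%g.

Lemma mem_mountain_perms m (s : 'S_m) :
  (s \in mountain_perms m) = ((s * rev_perm m)%g \in valley_perms m).
Proof. by rewrite mem_rcoset rev_permV. Qed.

Lemma mountain_permsP m (s : 'S_m) :
  reflect (forall i j k : 'I_m, (i < j)%N -> (j < k)%N ->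
             (minn (s i) (s k) < s j)%N)
          (s \in mountain_perms m).
Proof.
rewrite mem_mountain_perms.
apply: (iffP (valley_permsP _)) => mountain i j k ltij ltjk;
  by have := mountain i j k ltij ltjk;
    rewrite !permM gtn_min leq_max !rev_perm_ltn.
Qed.

Lemma valley_mountain_monotone m :
  valley_perms m :&: mountain_perms m \subset [set 1%g; rev_perm m].
Proof.
apply/subsetP => s /setIP[]; rewrite in_set2.
case: m s => [|m] s.
  by rewrite [s](_ : _ = 1%g) ?eqxx //; apply/permP; case.
move=> /valley_permsP no_peak /mountain_permsP no_pit.
have slope (i j : 'I_m.+1) : (i < j)%N ->
    (s i < s j)%N = (s ord0 < s ord_max)%N.
  move=> ltij; have lej : (j <= m)%N by rewrite -ltnS.
  have -> : (s i < s j)%N = (s ord0 < s j)%N.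
    have [i0|lt0i] := posnP i; first by congr (s _ < _)%N; apply: val_inj.
    have := no_peak ord0 i j lt0i ltij.
    by have := no_pit ord0 i j lt0i ltij; lia.
  have [jm|ltjm] := eqVneq (j : nat) m.
    by congr (_ < s _)%N; apply: val_inj.
  have lt0j : (@ord0 m < j)%N by apply: leq_ltn_trans ltij.
  have {ltjm}ltjm : (j < @ord_max m)%N by rewrite ltn_neqAle ltjm.
  by have := no_peak _ _ _ lt0j ltjm; have := no_pit _ _ _ lt0j ltjm; lia.
apply/orP; have [up|/negPf down] := boolP (s ord0 < s ord_max)%N.
  by left; apply/eqP/increasing_perm1 => i j /slope ->.
right; rewrite eq_mulgV1 rev_permV; apply/eqP/increasing_perm1 => i j ltij.
rewrite !permM rev_perm_ltn ltnNge leq_eqVlt slope // down orbF.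
by rewrite val_eqE (inj_eq perm_inj) -val_eqE ltn_eqF.
Qed.

Lemma card_valley_or_mountain m :
  (2 ^ m - 2 <= #|valley_perms m :|: mountain_perms m|)%N.
Proof.
case: m => [|m] //.
rewrite cardsU card_rcoset expnS mul2n -addnn.
apply: leq_sub; first by apply: leq_add; apply: card_valley_perms.
apply: leq_trans (subset_leq_card (valley_mountain_monotone _)) _.
by rewrite cards2; case: eqP.
Qed.

Section SubsetExpansion.
Variable I : finType.

Lemma prodrD_subsets (R : comPzSemiRingType) (x : R) (t : I -> R) :
  \prod_j (x + t j) = \sum_(J : {set I}) x ^+ #|J| * \prod_(j | j \notin J) t j.
Proof.
rewrite bigA_distr; apply: eq_bigr => J _.
rewrite (bigID (mem J)) /=; congr (_ * _).
  by rewrite -prodr_const; apply: eq_bigr => j ->.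
by apply: eq_bigr => j /negPf ->.
Qed.

(* Pairing with a sequence [a] is linear, so it is the expansion over subsets
   with each power [x ^+ k] replaced by [a k]. *)
Lemma sum_coef_prod_XsubC (R : comNzRingType) (a : nat -> R) (t : I -> R) :
  \sum_(k < #|I|.+1) a k * (\prod_j ('X - (t j)%:P))`_k =
  \sum_(J : {set I}) a #|J| * \prod_(j | j \notin J) - t j.
Proof.
set P := \prod_j _.
have coefP k : P`_k =
    \sum_(J : {set I}) (k == #|J|)%:R * \prod_(j | j \notin J) - t j.
  rewrite /P prodrD_subsets coef_sum; apply: eq_bigr => J _.
  rewrite (eq_bigr (fun j => (- t j)%:P)) => [|j _]; last by rewrite polyCN.
  by rewrite -rmorph_prod coefMC coefXn.
under eq_bigr => k _ do rewrite coefP mulr_sumr.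
rewrite exchange_big; apply: eq_bigr => J _ /=.
have ltJ : (#|J| < #|I|.+1)%N by rewrite ltnS max_card.
rewrite (bigD1 (Ordinal ltJ)) //= eqxx mul1r [X in _ + X]big1 ?addr0 // => k.
by rewrite -val_eqE /= => /negPf ->; rewrite mul0r mulr0.
Qed.

End SubsetExpansion.

Lemma expr1D_le_chord (R : realDomainType) (x : R) m : 0 <= x <= 1 ->
  (1 + x) ^+ m <= 1 + (2 ^+ m - 1) * x.
Proof.
move=> /andP[x_ge0 x_le1]; elim: m => [|m IHm].
  by rewrite !expr0 subrr mul0r addr0.
have pow2_ge1 : 1 <= 2 ^+ m :> R by apply: exprn_ege1; lra.
have : 0 <= (2 ^+ m - 1) * (x * (1 - x)) by rewrite !mulr_ge0 // subr_ge0.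
have : (1 + x) ^+ m * (1 + x) <= (1 + (2 ^+ m - 1) * x) * (1 + x).
  by rewrite ler_wpM2r // addr_ge0.
by rewrite !exprSr; lra.
Qed.

Section SeparatedNodes.
Variables (R : realFieldType) (I : finType) (T x : R) (t : I -> R).
Hypothesis T_ge : 2 ^+ #|I|.+1 <= T.
Hypothesis x_gt0 : 0 < x.
Hypothesis t_gt0 : forall j, 0 < t j.
Hypothesis separated : forall j, T * Num.min x (t j) <= Num.max x (t j).

Let T_ge1 : 1 <= T.
Proof. by apply: le_trans T_ge; apply: exprn_ege1; lra. Qed.

Lemma prodD_le_prod_max :
  \prod_j (x + t j) <= 3 / 2 * \prod_j Num.max x (t j).
Proof.
have T_gt0 : 0 < T by apply: lt_le_trans T_ge1.
have growth : (1 + T^-1) ^+ #|I| <= 3 / 2.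
  have invT : 0 <= T^-1 <= 1 by rewrite invr_ge0 ltW //= invf_le1.
  apply: le_trans (expr1D_le_chord _ invT) _.
  suff : (2 ^+ #|I| - 1) * T^-1 <= 1 / 2 by lra.
  by rewrite ler_pdivrMr //; move: T_ge; rewrite ?exprSr; lra.
have max_gt0 j : 0 < Num.max x (t j) by rewrite lt_max x_gt0.
apply: (@le_trans _ _ (\prod_j ((1 + T^-1) * Num.max x (t j)))).
  apply: ler_prod => j _; rewrite (ltW (addr_gt0 x_gt0 (t_gt0 j))) /=.
  rewrite -[x + _]addr_max_min mulrDl mul1r.
  by rewrite lerD2l mulrC ler_pdivlMr // mulrC.
rewrite big_split /= prodr_const ler_pM2r //.
exact: prodr_gt0.
Qed.

Lemma prod_max_subset (J := [set j | t j < x]) :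
  \prod_j Num.max x (t j) = x ^+ #|J| * \prod_(j | j \notin J) t j.
Proof.
rewrite (bigID (mem J)) /=; congr (_ * _).
  rewrite -prodr_const; apply: eq_bigr => j.
  by rewrite inE => /ltW /max_idPl.
by apply: eq_bigr => j; rewrite inE -leNgt => /max_idPr.
Qed.

Lemma dominant_subset (c : nat -> R) (J := [set j | t j < x])
    (M := \prod_j Num.max x (t j)) :
  (forall k, `|c k| <= 1) ->
  `|\sum_(k < #|I|.+1) c k * x ^+ k * (\prod_j ('X - (t j)%:P))`_k
    - (-1) ^+ #|~: J| * c #|J| * M| <= M / 2.
Proof.
move=> c_le1.
have signE (K : {set I}) : \prod_(j | j \notin K) - t j =
    (-1) ^+ #|~: K| * \prod_(j | j \notin K) t j.
  by rewrite prodrN; congr ((-1) ^+ _ * _); apply: eq_card => j; rewrite !inE.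
have term_ge0 (K : {set I}) : 0 <= x ^+ #|K| * \prod_(j | j \notin K) t j.
  by rewrite mulr_ge0 ?exprn_ge0 ?prodr_ge0 // => *; apply: ltW.
rewrite (sum_coef_prod_XsubC (fun k => c k * x ^+ k)) (bigD1 J) //=.
rewrite signE /M prod_max_subset -/J.
set u := x ^+ _ * _.
rewrite (_ : c #|J| * x ^+ #|J| * _ = (-1) ^+ #|~: J| * c #|J| * u); last first.
  by rewrite /u; ring.
rewrite addrAC subrr add0r; apply: le_trans (ler_norm_sum _ _ _) _.
apply: (@le_trans _ _
  (\sum_(K : {set I} | K != J) x ^+ #|K| * \prod_(j | j \notin K) t j)).
  apply: ler_sum => K _; rewrite signE mulrCA normrMsign -mulrA normrM.
  by rewrite (ger0_norm (term_ge0 K)) -[leRHS]mul1r ler_wpM2r.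
have := prodD_le_prod_max; rewrite prod_max_subset -/J -/u.
by rewrite prodrD_subsets (bigD1 J) //= -/u; lra.
Qed.

End SeparatedNodes.

Lemma size_prod_XsubC_card (R : nzRingType) (I : finType) (t : I -> R) :
  size (\prod_j ('X - (t j)%:P)) = #|I|.+1.
Proof. by rewrite size_prod_XsubC /index_enum -enumT -cardE. Qed.

Lemma coef_card_prod_XsubC (R : nzRingType) (I : finType) (t : I -> R) :
  (\prod_j ('X - (t j)%:P))`_#|I| = 1.
Proof.
have /monicP := monic_prod_XsubC (index_enum I) predT t.
by rewrite lead_coefE size_prod_XsubC_card.
Qed.

Section MomentCurve.
Variables (R : comNzRingType) (m : nat).

(* The coordinate of degree [m] is the first one, which spares a sign in
   [det_moment]. *)
Definition coords (a : nat -> R) : 'cV[R]_(1 + m) :=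
  col_mx (a m)%:M (\col_(k < m) a k).

Definition moment (x : R) : 'cV[R]_(1 + m) := coords (fun k => x ^+ k).

Lemma moment_neq0 (x : R) : (0 < m)%N -> moment x != 0.
Proof.
move=> m_gt0; apply/eqP => /matrixP/(_ (rshift 1 (Ordinal m_gt0)) 0).
by rewrite col_mxEd !mxE expr0 => /eqP; rewrite oner_eq0.
Qed.

Lemma row_coef_mul_Vandermonde (t : 'rV[R]_m) :
  (\row_(k < m) (\prod_j ('X - (t 0 j)%:P))`_k) *m Vandermonde m t =
  - \row_j t 0 j ^+ m.
Proof.
set P := \prod_j _; apply/rowP => j; rewrite !mxE.
have lead_P : P`_m = 1 by rewrite -[m in P`_m]card_ord coef_card_prod_XsubC.
have : P.[t 0 j] = 0.
  by rewrite horner_prod (bigD1 j) //= hornerXsubC subrr mul0r.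
rewrite (@horner_coef_wide _ m.+1) ?size_prod_XsubC_card ?card_ord //
  big_ord_recr /= lead_P mul1r.
move/eqP; rewrite addr_eq0 => /eqP <-.
by apply: eq_bigr => k _; rewrite !mxE.
Qed.

Lemma det_moment (a : nat -> R) (t : 'rV[R]_m) :
  \det (row_mx (coords a) (\matrix_(i, j) moment (t 0 j) i 0)) =
  (\prod_(i < m) \prod_(j < m | (i < j)%N) (t 0 j - t 0 i)) *
  \sum_(k < m.+1) a k * (\prod_j ('X - (t 0 j)%:P))`_k.
Proof.
set P := \prod_j _; set coefs := \row_(k < m) P`_k.
have momentE : \matrix_(i, j) moment (t 0 j) i 0 =
    col_mx (\row_j t 0 j ^+ m) (Vandermonde m t).
  apply/matrixP => i j; rewrite !mxE; case: splitP => k _; rewrite !mxE //.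
  by rewrite !ord1 eqxx.
(* Adding to the first row the combination of the others with the coefficients
   of [P], which vanishes at the nodes, clears it but for its first entry. *)
have det_unip : \det (block_mx 1%:M coefs 0 1%:M : 'M_(1 + m)) = 1.
  by rewrite det_ublock !det1 mulr1.
rewrite momentE /coords -block_mxEh -[LHS]mul1r -[X in X * _ = _]det_unip.
rewrite -det_mulmx mulmx_block !mul1mx !mul0mx !add0r.
rewrite row_coef_mul_Vandermonde subrr.
rewrite det_lblock det_Vandermonde mulrC det_mx11 !mxE big_ord_recr /=.
rewrite -[m in P`_m]card_ord coef_card_prod_XsubC mulr1 mulr1n addrC.
by congr (_ * (_ + _)); apply: eq_bigr => k _; rewrite !mxE mulrC.
Qed.

End MomentCurve.

Section Representatives.
Variables (R : realType) (d : nat).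

Definition homogeneous_rep n (p : 'I_n -> line_rep R d) (s : 'S_d.-1) : Prop :=
  forall f : 'I_d.-1 -> 'I_n, {homo f : i j / (i < j)%N} ->
  forall i j : 'I_d.-1, (i < j)%N ->
    height_rep (p \o f) (s i) < height_rep (p \o f) (s j).

Lemma has_type_general_position (L : 'I_d.-1 -> oriented_line R d)
    (s : 'S_d.-1) :
  has_type L s -> general_position L.
Proof.
move=> type_s i j; rewrite -[i](permKV s) -[j](permKV s).
by move/(inc_inj (le_mono type_s)) ->.
Qed.

Lemma universal_type_rep (s : 'S_d.-1) :
  universal_type R s <->
  forall n, (d.-1 <= n)%N ->
    exists p : 'I_n -> line_rep R d, homogeneous_rep p s.
Proof.
split=> univ n /univ[].
  move=> K hom_K; exists (fun l => repr (K l)) => f f_incr.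
  by have [_] := hom_K f f_incr.
move=> p hom_p; exists (fun l => \pi_(oriented_line R d) (p l)) => f f_incr.
suff type_s : has_type ((fun l => \pi_(oriented_line R d) (p l)) \o f) s.
  by split=> //; apply: has_type_general_position type_s.
by apply/(@has_type_rep _ _ _ (p \o f)) => //; apply: hom_p.
Qed.

End Representatives.

Section Reversal.
Variables (R : realType) (m : nat).

Lemma det_column_matrix_perm (a : 'cV[R]_(1 + m)) (v : 'I_m -> 'cV[R]_(1 + m))
    (b : R) (s : 'S_m) :
  \det (column_matrix (b *: a) (v \o s)) =
  b * (-1) ^+ s * \det (column_matrix a v).
Proof.
rewrite !column_matrixE; set V := \matrix_(i, j) v j i ord0.
have -> : \matrix_(i, j) (v \o s) j i ord0 = V *m perm_mx s^-1.
  by rewrite -col_permE; apply/matrixP => i j; rewrite !mxE.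
have -> : row_mx (b *: a) (V *m perm_mx s^-1) =
    row_mx a V *m block_mx b%:M 0 0 (perm_mx s^-1).
  by rewrite mul_row_block !mulmx0 addr0 add0r mul_mx_scalar.
by rewrite det_mulmx det_ublock det_scalar expr1 det_perm odd_permV mulrC.
Qed.

Definition scale_base (b : R) (p : line_rep R m.+1) : line_rep R m.+1 :=
  exist (fun p : 'cV[R]_m.+1 * 'cV[R]_m.+1 => p.2 != 0)
    (b *: base_point p, direction p) (valP p).

Lemma height_rep_perm (p : 'I_m -> line_rep R m.+1) (s : 'S_m) (i : 'I_m) :
  @height_rep R m.+1 (scale_base ((-1) ^+ s) \o (p \o s)) i =
  @height_rep R m.+1 p (s i).
Proof.
rewrite /height_rep [LHS](det_column_matrix_perm _ (fun j => direction (p j))).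
by rewrite -expr2 sqrr_sign mul1r.
Qed.

(* Reversing a sequence of lines reverses the order of the directions in each
   determinant; scaling the base points by the sign of that permutation
   compensates for it. *)
Lemma universal_type_rev (s : 'S_m) :
  @universal_type R m.+1 s -> @universal_type R m.+1 (s * rev_perm m)%g.
Proof.
move=> /universal_type_rep univ; apply/universal_type_rep => n /univ[p hom_p].
pose sign : R := (-1) ^+ rev_perm m.
exists (fun l => scale_base sign (p (rev_perm n l))) => f f_incr i j ltij.
pose f' k := rev_perm n (f (rev_perm m k)).
have f'_incr : {homo f' : k l / (k < l)%N}.
  by move=> k l ltkl; rewrite rev_perm_ltn f_incr ?rev_perm_ltn.
have heightE k : @height_rep R m.+1
    ((fun l => scale_base sign (p (rev_perm n l))) \o f) (rev_perm m k) =
    @height_rep R m.+1 (p \o f') k.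
  rewrite -[k in RHS]rev_permK -[RHS]height_rep_perm; congr (height_rep _ _).
  by apply/funext => l; rewrite /f' /= rev_permK.
by rewrite !permM !heightE; apply: hom_p.
Qed.

End Reversal.

Lemma card_ltn_ord n (i : 'I_n) : #|[set j : 'I_n | (j < i)%N]| = i.
Proof.
rewrite -[RHS]card_ord -sum1_card -[RHS]sum1_card.
rewrite (eq_bigl (fun j : 'I_n => (j < i)%N)) => [|j]; last by rewrite inE.
by rewrite -(big_ord_narrow (F := fun=> 1%N) (ltnW (ltn_ord i))).
Qed.

Section SignedLines.
Variables (R : realType) (m : nat) (negative : nat -> bool).

Definition separation : R := 2 ^+ m.+2.

Definition node (l : nat) : R := separation ^+ l.*2.+1.

Definition point (l : nat) : R := separation ^+ l.*2.

(* The first factor cancels the sign of the coefficient of degree [k] of a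
   monic polynomial of degree [m.+1] with positive roots. *)
Definition coord_sign (k : nat) : R := (-1) ^+ (m.+1 - k) * (-1) ^+ negative k.

Definition signed_line (l : nat) : line_rep R m.+2 :=
  exist (fun p : 'cV[R]_m.+2 * 'cV[R]_m.+2 => p.2 != 0)
    (coords m.+1 (fun k => coord_sign k * point l ^+ k), moment m.+1 (node l))
    (moment_neq0 (node l) (ltn0Sn m)).

Let separation_gt1 : 1 < separation.
Proof. by apply: exprn_egt1; rewrite // ltr1n. Qed.

Let separation_gt0 : 0 < separation.
Proof. exact: lt_trans separation_gt1. Qed.

Let point_gt0 l : 0 < point l.
Proof. exact: exprn_gt0. Qed.

Let node_gt0 l : 0 < node l.
Proof. exact: exprn_gt0. Qed.

Lemma node_lt_point k l : (node k < point l) = (k < l)%N.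
Proof. by rewrite ltr_eXn2l //; lia. Qed.

Lemma node_point_separated k l :
  separation * Num.min (point k) (node l) <= Num.max (point k) (node l).
Proof.
by have [|] := lerP (point k) (node l);
  rewrite ?(leNgt (point k)) node_lt_point -exprS ler_eXn2l //; lia.
Qed.

Variable f : 'I_m.+1 -> nat.
Hypothesis f_incr : {homo f : i j / (i < j)%N}.

Definition node_vandermonde : R :=
  \prod_(i < m.+1) \prod_(j < m.+1 | (i < j)%N) (node (f j) - node (f i)).

Definition reduced_height (i : 'I_m.+1) : R :=
  \sum_(k < m.+2) coord_sign k * point (f i) ^+ k *
    (\prod_j ('X - (node (f j))%:P))`_k.

Definition max_prod (i : 'I_m.+1) : R :=
  \prod_j Num.max (point (f i)) (node (f j)).

Lemma node_vandermonde_gt0 : 0 < node_vandermonde.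
Proof.
apply: prodr_gt0 => i _; apply: prodr_gt0 => j /f_incr ltij.
by rewrite subr_gt0 ltr_eXn2l //; lia.
Qed.

Lemma height_signed_line (i : 'I_m.+1) :
  @height_rep R m.+2 (signed_line \o f) i = node_vandermonde * reduced_height i.
Proof.
rewrite /height_rep (@column_matrixE R m.+1).
rewrite (_ : \matrix_(r, c) _ =
  \matrix_(r, c) moment m.+1 ((\row_j node (f j)) 0 c) r 0); last first.
  by apply/matrixP => r c; rewrite !mxE.
rewrite det_moment; congr (_ * _).
  by apply: eq_bigr => j _; apply: eq_bigr => k _; rewrite !mxE.
apply: eq_bigr => k _; congr (_ * (polyseq _)`_k).
by apply: eq_bigr => j _; rewrite mxE.
Qed.

Lemma reduced_height_approx (i : 'I_m.+1) :
  `|reduced_height i - (-1) ^+ negative i * max_prod i| <= max_prod i / 2.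
Proof.
have coord_sign_le1 k : `|coord_sign k| <= 1 by rewrite normrMsign normr_sign.
have lowE : [set j | node (f j) < point (f i)] = [set j : 'I_m.+1 | (j < i)%N].
  apply/setP => j; rewrite !inE node_lt_point.
  exact: (leW_mono (le_mono f_incr)).
have := @dominant_subset R 'I_m.+1 separation (point (f i)) (node \o f) _
  (point_gt0 _) (fun j => node_gt0 (f j))
  (fun j => node_point_separated (f i) (f j)) _ coord_sign_le1.
rewrite /= lowE card_ltn_ord card_ord => /(_ (lexx _)).
rewrite [#|~: _|]cardsCs setCK card_ltn_ord card_ord.
by rewrite /coord_sign signrMK.
Qed.

Lemma max_prod_gt0 (i : 'I_m.+1) : 0 < max_prod i.
Proof. by apply: prodr_gt0 => j _; rewrite lt_max point_gt0. Qed.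

Lemma max_prod_growth (i k : 'I_m.+1) : (i < k)%N ->
  separation * max_prod i <= max_prod k.
Proof.
move=> ltik; have lt_f := f_incr ltik.
rewrite /max_prod (bigD1 i) //= [leRHS](bigD1 i) //= mulrA.
have le_point : point (f i) <= point (f k) by rewrite ler_eXn2l //; lia.
have max_ge0 l j : 0 <= Num.max (point l) (node j) by rewrite le_max ltW.
apply: ler_pM.
- by apply: mulr_ge0; first exact: ltW.
- exact: prodr_ge0.
- have /max_idPr -> : point (f i) <= node (f i) by rewrite ler_eXn2l.
  by rewrite le_max -exprS ler_eXn2l //; apply/orP; left; lia.
- by apply: ler_prod => j _; rewrite max_ge0 ge_max !le_max le_point lexx orbT.
Qed.

Lemma signed_line_dominance (i k : 'I_m.+1) : (i < k)%N ->
  `|@height_rep R m.+2 (signed_line \o f) i| <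
    (-1) ^+ negative k * @height_rep R m.+2 (signed_line \o f) k.
Proof.
move=> ltik; have separation_ge4 : 4 <= separation.
  rewrite /separation !exprS mulrA -natrM ler_peMr //.
  by apply: exprn_ege1; rewrite ler1n.
have growth : 4 * max_prod i <= max_prod k.
  apply: le_trans (max_prod_growth ltik).
  by rewrite ler_wpM2r // ltW // max_prod_gt0.
rewrite !height_signed_line normrM (gtr0_norm node_vandermonde_gt0).
rewrite [ltRHS]mulrCA ltr_pM2l ?node_vandermonde_gt0 //.
have := reduced_height_approx i; have := reduced_height_approx k.
have := max_prod_gt0 i.
rewrite !ler_norml ltr_norml.
by case: (negative i) (negative k) => [] []; rewrite ?expr1 ?expr0; lra.
Qed.

End SignedLines.

(* An entry of [s] is given a negative height when a smaller one comes later: in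
   a valley word, these are the entries of the decreasing part. *)
Lemma valley_universal (R : realType) m (s : 'S_m.+1) :
  s \in valley_perms m.+1 -> @universal_type R m.+2 s.
Proof.
move=> /valley_permsP valley; apply/universal_type_rep => n _.
pose negative (l : nat) :=
  [exists i : 'I_m.+1, exists j : 'I_m.+1,
     [&& (i < j)%N, s i == l :> nat & (s j < l)%N]].
exists (fun l => signed_line R m negative l) => f f_incr i j ltij.
have dominance := @signed_line_dominance R m negative (fun k => f k) f_incr.
have [lt_s|gt_s|/val_inj/perm_inj eq_ij] := ltngtP (s i) (s j).
- have pos_j : negative (s j) = false.
    apply/existsP => -[j' /existsP[k /and3P[ltjk eq_j lt_k]]].
    move: eq_j ltjk => /eqP/val_inj/perm_inj -> ltjk.
    have := valley _ _ _ ltij ltjk.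
    by rewrite leq_max ltnNge (ltnW lt_s) ltnNge (ltnW lt_k).
  have := dominance _ _ lt_s; rewrite pos_j expr0 mul1r.
  exact/le_lt_trans/ler_norm.
- have neg_i : negative (s i).
    by apply/existsP; exists i; apply/existsP; exists j; rewrite ltij eqxx.
  have := dominance _ _ gt_s; rewrite neg_i expr1 mulN1r ltrNr.
  by move/lt_le_trans; apply; rewrite lerNl -normrN ler_norm.
by rewrite eq_ij ltnn in ltij.
Qed.

Theorem theorem3p3 (R : realType) (d : nat) (hd : (3 <= d)%N) :
  exists A : {set 'S_d.-1},
    (2 ^ d.-1 - 2 <= #|A|)%N /\
    (forall s : 'S_d.-1, s \in A -> universal_type R s).
Proof.
case: d hd => [|[|m]] // _.
exists (valley_perms m.+1 :|: mountain_perms m.+1); split.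
  exact: card_valley_or_mountain.
move=> s /setUP[|/rcosetP[r valley_r ->]]; first exact: valley_universal.
by apply: universal_type_rev; apply: valley_universal.
Qed.
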